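(* Every consistent atomic RCC8 network over $\{\mathbf{DC},\mathbf{TPP},\mathbf{TPP}^{-1},\mathbf{NTPP},\mathbf{NTPP}^{-1}\}$ has a convex solution in $\mathbb{R}^2$.
   Context: A region in $\mathbb{R}^n$ ($n\geq 1$) is a nonempty regular closed subset $X$, i.e. $X=\mathrm{cl}(\mathrm{int}(X))$; write $i(X)$ for the interior. The eight RCC8 base relations between regions $a,b$ (jointly exhaustive and pairwise disjoint; $\subset$ denotes proper inclusion) are: $a\,\mathbf{EQ}\,b$: $a=b$; $a\,\mathbf{DC}\,b$: $a\cap b=\emptyset$; $a\,\mathbf{EC}\,b$: $a\cap b\neq\emptyset$ and $i(a)\cap i(b)=\emptyset$; $a\,\mathbf{PO}\,b$: $i(a)\cap i(b)\neq\emptyset$, $a\not\subseteq b$, $b\not\subseteq a$; $a\,\mathbf{TPP}\,b$: $a\subset b$ and $a\not\subset i(b)$; $a\,\mathbf{NTPP}\,b$: $a\subset i(b)$; and the converses $\mathbf{TPP}^{-1}$, $\mathbf{NTPP}^{-1}$ of the last two. Let $V$ be a finite set of variables. An RCC8 constraint is an expression $u\,R\,v$ with $u,v\in V$ and $R$ a nonempty set of base relations; an RCC8 network is a set of such constraints. It is atomic if for every pair of distinct variables $u,v$ it contains a constraint $u\,R\,v$ or $v\,R\,u$ with $R$ a singleton. It is a network over a set $\mathcal{R}$ of base relations if every constraint $u\,R\,v$ in it has $R\subseteq\mathcal{R}$. An $n$-dimensional solution (solution in $\mathbb{R}^n$) of a network is a map $\mathcal{S}$ from $V$ to regions of $\mathbb{R}^n$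 such that for each constraint $u\,R\,v$ the base relation holding between $\mathcal{S}(u)$ and $\mathcal{S}(v)$ belongs to $R$. A network is consistent if it has a solution in $\mathbb{R}^n$ for some $n\geq 1$ (the regions need not be convex or connected). A solution is convex if every $\mathcal{S}(v)$ is a convex set. *)

(* Defs.v *)
From mathcomp Require Import all_boot all_order all_algebra.
From mathcomp Require Import all_classical all_reals all_analysis.
Import numFieldNormedType.Exports.

Set Implicit Arguments.
Unset Strict Implicit.
Unset Printing Implicit Defensive.

Local Open Scope classical_set_scope.

Inductive rcc8 : Type := EQ | DC | EC | PO | TPP | TPPi | NTPP | NTPPi.

(* [A `<` B] is proper inclusion. *)
Definition rcc8_rel (T : topologicalType) (r : rcc8) (a b : set T) : Prop :=
  match r with
  | EQ => a = b
  | DC => a `&` b = set0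
  | EC => a `&` b <> set0 /\ interior a `&` interior b = set0
  | PO => [/\ interior a `&` interior b <> set0, ~ (a `<=` b) & ~ (b `<=` a)]
  | TPP => a `<` b /\ ~ (a `<` interior b)
  | TPPi => b `<` a /\ ~ (b `<` interior a)
  | NTPP => a `<` interior b
  | NTPPi => b `<` interior a
  end.

Definition region (T : topologicalType) (a : set T) : Prop :=
  a !=set0 /\ regclosed a.

Record rcc8_constraint (V : Type) : Type := Rcc8Constraint {
  lhs : V;
  rels : set rcc8;
  rhs : V;
  rels_neq0 : rels !=set0
}.

Definition rcc8_network (V : Type) : Type := set (rcc8_constraint V).

Definition atomic (V : Type) (N : rcc8_network V) : Prop :=
  forall u v : V, u <> v ->
    exists c, [/\ N c,
      (lhs c = u /\ rhs c = v) \/ (lhs c = v /\ rhs c = u) &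
      exists r, rels c = [set r]].

Definition network_over (V : Type) (N : rcc8_network V) (D : set rcc8) : Prop :=
  forall c, N c -> rels c `<=` D.

Definition solution (R : realType) (n : nat) (V : Type) (N : rcc8_network V)
    (S : V -> set 'rV[R]_n) : Prop :=
  (forall v, region (S v)) /\
  (forall c, N c -> exists2 r, rels c r & rcc8_rel r (S (lhs c)) (S (rhs c))).

Definition consistent (R : realType) (V : Type) (N : rcc8_network V) : Prop :=
  exists n : nat, (1 <= n)%N /\ exists S : V -> set 'rV[R]_n, solution N S.

(* [convex_set] expects sets over the tagged copy [convex_lmodType] of the
   vector space. *)
Definition convex_solution (R : realType) (n : nat) (V : Type)
    (N : rcc8_network V) (S : V -> set 'rV[R]_n) : Prop :=
  solution N S /\
  forall v, convex_set (S v : set (convex_lmodType 'rV[R]_n)).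

(* Main.v *)
Require Import Defs.
From mathcomp Require Import all_boot all_order all_algebra.
From mathcomp Require Import all_classical all_reals all_analysis.
From mathcomp Require Import lra.

(* In a solution, the sets of a network over these relations form a forest under
   inclusion, so they can be laid out as nested or disjoint intervals on the
   X-axis, each carrying a marker x u that stays at distance at least 1 from all
   intervals not containing it.  The region of w is a box over its interval, cut
   below by the parabola Y = X^2 lowered by a height h w < 1 that increases along
   inclusion.  Adding the tangent of the unlowered parabola at x u to exactly those
   regions w in which u is not a nontangential proper part makes u and w share the
   boundary point (x u, (x u)^2), and has no effect on the regions whose interval
   does not contain x u. *)

Import Order.TTheory GRing.Theory Num.Theory numFieldNormedType.Exports.

Local Open Scope classical_set_scope.
Local Open Scope ring_scope.

(** * Finite forests as nested intervals *)

Lemma finite_maximal {T : finType} {le : rel T} (A : {set T}) :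
  reflexive le -> transitive le -> antisymmetric le -> A != finset.set0 ->
  exists2 r, r \in A & forall w, w \in A -> le r w -> w = r.
Proof.
move=> le_refl le_trans le_anti /set0Pn[r0 r0A].
(* An element with the most elements below it is maximal: anything strictly above it would dominate
   all of these and also itself. *)
case: (arg_maxnP (fun r => #|[set u | le u r]%SET|) r0A) => r rA r_max.
exists r => // w wA le_rw; apply/eqP/negPn/negP => neq_wr.
have /= := r_max w wA; apply/negP; rewrite -ltnNge.
apply: proper_card; apply/properP; split.
  by apply/fintype.subsetP => u; rewrite !inE => /le_trans; apply.
exists w; rewrite !inE ?le_refl//; apply/negP => le_wr.
by move/eqP: neq_wr; apply; apply: le_anti; rewrite le_wr.
Qed.

(* A depth-first layout of the forest: the marker [x w] lies in [w]'s interval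
   to the right of the intervals of all proper descendants. *)
Lemma laminar_intervals {R : realFieldType} {T : finType} {le : rel T} :
  reflexive le -> transitive le -> antisymmetric le ->
  (forall u v w, le u v -> le u w -> le v w || le w v) ->
  exists x a b : T -> R,
  [/\ forall w, a w < x w < b w,
      forall v w, le v w -> v != w -> a w < a v /\ b v < b w,
      forall v w, ~~ le v w -> ~~ le w v -> b v < a w \/ b w < a v &
      forall u w, ~~ le u w -> x u + 1 <= a w \/ b w + 1 <= x u].
Proof.
move=> le_refl le_trans le_anti le_lam.
(* Induction on cardinality: a subset [A] is laid out to the right of a given [L], and the right end
   [M] is part of the output. Unit margins at both ends of the window keep blocks laid side by side
   apart. *)
suff layout n : forall (A : {set T}) (L : R), (#|A| <= n)%N ->
  exists (x a b : T -> R) (M : R), L <= M /\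
  [/\ forall w, w \in A ->
        [/\ L + 1 <= a w, a w + 1 <= x w, x w + 1 <= b w & b w + 1 <= M],
      forall v w, v \in A -> w \in A -> le v w -> v != w ->
        a w < a v /\ b v < b w,
      forall v w, v \in A -> w \in A -> ~~ le v w -> ~~ le w v ->
        b v < a w \/ b w < a v &
      forall u w, u \in A -> w \in A -> ~~ le u w ->
        x u + 1 <= a w \/ b w + 1 <= x u].
  have [x [a [b [M [_ [P1 P2 P3 P4]]]]]] := layout _ [set: T]%SET 0 (leqnn _).
  exists x, a, b; split=> [w|v w|v w|u w].
  - by have [] := P1 w (finset.in_setT w) => *; lra.
  - exact: P2 (finset.in_setT v) (finset.in_setT w).
  - exact: P3 (finset.in_setT v) (finset.in_setT w).
  - exact: P4 (finset.in_setT u) (finset.in_setT w).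
elim: n => [|n IHn] A L cardA.
  move: cardA; rewrite leqn0 cards_eq0 => /eqP->.
  exists (fun=> 0), (fun=> 0), (fun=> 0), L; split=> //.
  by split=> [w|v w|v w|u w]; rewrite finset.in_set0.
have [->|A_neq0] := eqVneq A finset.set0.
  by apply: IHn; rewrite cards0.
have [r rA r_max] := finite_maximal A le_refl le_trans le_anti A_neq0.
(* [r] is the root of a tree of the forest: [A1] holds its proper descendants and [A2] everything
   outside its tree. *)
pose A1 := [set u in A | le u r & u != r]%SET.
pose A2 := [set u in A | ~~ le u r]%SET.
have card_lt (B : {set T}) : B \subset A -> r \notin B -> (#|B| <= n)%N.
  move=> BA rB; rewrite -ltnS; apply: leq_trans cardA; apply: proper_card.
  by apply/properP; split=> //; exists r.
have cardA1 : (#|A1| <= n)%N.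
  apply: card_lt; last by rewrite inE eqxx !andbF.
  by apply/fintype.subsetP => u; rewrite inE => /andP[].
have cardA2 : (#|A2| <= n)%N.
  apply: card_lt; last by rewrite inE le_refl andbF.
  by apply/fintype.subsetP => u; rewrite inE => /andP[].
have [x1 [a1 [b1 [M1 [LM1 [P1 P2 P3 P4]]]]]] := IHn A1 (L + 1) cardA1.
have [x2 [a2 [b2 [M2 [LM2 [Q1 Q2 Q3 Q4]]]]]] := IHn A2 (M1 + 2) cardA2.
pose glue (f1 : T -> R) c f2 u := if u == r then c else if le u r then f1 u else f2 u.
(* From left to right: [a r], the block of [A1], the marker of [r], [b r], the block of [A2]. The
   final [M2 + 1] leaves a margin after [b r] even when [A2] is empty. *)
exists (glue x1 (M1 + 1) x2), (glue a1 (L + 1) a2), (glue b1 (M1 + 2) b2), (M2 + 1).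
have glue_r f1 c f2 : glue f1 c f2 r = c by rewrite /glue eqxx.
have glue1 f1 c f2 u : u \in A1 -> glue f1 c f2 u = f1 u.
  by rewrite !inE /glue => /and3P[_ -> /negbTE->].
have glue2 f1 c f2 u : u \in A2 -> glue f1 c f2 u = f2 u.
  rewrite !inE /glue => /andP[_ nle]; rewrite (negbTE nle).
  by case: eqVneq nle => // ->; rewrite le_refl.
have case_A u : u \in A -> [\/ u = r, u \in A1 | u \in A2].
  move=> uA; rewrite !inE uA /=.
  case: (eqVneq u r) => [|_]; first by constructor 1.
  by case: (le u r); [constructor 2|constructor 3].
have A1r u : u \in A1 -> le u r by rewrite inE => /and3P[].
have A2r u : u \in A2 -> ~~ le u r by rewrite inE => /andP[].
have rA2 w : w \in A2 -> ~~ le r w.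
  move=> wA2; apply/negP => /r_max wr; move: (A2r w wA2); rewrite wr ?le_refl//.
  by move: wA2; rewrite inE => /andP[].
(* Otherwise [v] would lie below both [r] and [w], and laminarity would make these comparable. *)
have A12 v w : v \in A1 -> w \in A2 -> ~~ le v w.
  move=> vA1 wA2; apply/negP => le_vw.
  have := le_lam _ _ _ le_vw (A1r _ vA1).
  by rewrite (negbTE (A2r w wA2)) (negbTE (rA2 w wA2)).
have A21 v w : v \in A2 -> w \in A1 -> ~~ le v w.
  move=> vA2 wA1; apply/negP => le_vw.
  by have := A2r v vA2; rewrite (le_trans _ _ _ le_vw (A1r w wA1)).
split; first lra.
split=> [w /case_A[->|wA|wA]|v w /case_A[->|vA|vA] /case_A[->|wA|wA]
        |v w /case_A[->|vA|vA] /case_A[->|wA|wA]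
        |v w /case_A[->|vA|vA] /case_A[->|wA|wA]];
  rewrite ?glue_r ?(glue1 _ _ _ _ wA) ?(glue1 _ _ _ _ vA)
          ?(glue2 _ _ _ _ wA) ?(glue2 _ _ _ _ vA) ?le_refl//.
- by split; lra.
- by have [] := P1 w wA; split; lra.
- by have [] := Q1 w wA; split; lra.
- by rewrite eqxx.
- move=> le_rw neq; move: wA; rewrite inE => /and3P[wA _ /eqP[]].
  exact: r_max.
- by rewrite (negbTE (rA2 w wA)).
- by move=> _ _; have [] := P1 v vA; split; lra.
- exact: P2.
- by rewrite (negbTE (A12 _ _ vA wA)).
- by rewrite (negbTE (A2r v vA)).
- by rewrite (negbTE (A21 _ _ vA wA)).
- exact: Q2.
- by rewrite (A1r w wA).
- by move=> _ _; left; have [] := Q1 w wA; lra.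
- by rewrite (A1r v vA).
- exact: P3.
- by move=> _ _; left; have [] := P1 v vA; have [] := Q1 w wA; lra.
- by move=> _ _; right; have [] := Q1 v vA; lra.
- by move=> _ _; right; have [] := P1 w wA; have [] := Q1 v vA; lra.
- exact: Q3.
- by move=> _; right; have [] := P1 w wA; lra.
- by move=> _; left; have [] := Q1 w wA; lra.
- by rewrite (A1r v vA).
- exact: P4.
- by move=> _; left; have [] := P1 v vA; have [] := Q1 w wA; lra.
- by move=> _; right; have [] := Q1 v vA; lra.
- by move=> _; right; have [] := P1 w wA; have [] := Q1 v vA; lra.
- exact: Q4.
Qed.

(** * Regions cut out by finitely many continuous convex inequalities *)

Lemma nbhs_ray {R : realType} {E : normedModType R} (p e : E) (U : set E) :
  nbhs p U -> \forall t \near 0^'+, U (p + t *: e).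
Proof.
move=> Up.
have ray_cvg : p + t *: e @[t --> 0^'+] --> p + (0 : R) *: e.
  apply: cvg_at_right_filter; apply: cvgD; first exact: cvg_cst.
  by apply: cvgZr_tmp; exact: cvg_id.
by rewrite scale0r addr0 in ray_cvg; exact: ray_cvg.
Qed.

Section convex_sublevel.
Context {R : realType} {E : normedModType R} {I : finType}.
Variable f : I -> E -> R.
Hypothesis f_cont : forall i, continuous (f i).
Hypothesis f_convex : forall i p q t, 0 <= t -> t <= 1 ->
  f i (t *: p + (1 - t) *: q) <= t * f i p + (1 - t) * f i q.

Lemma strict_sublevel_interior p :
  (forall i, f i p < 0) -> interior [set q | forall i, f i q <= 0] p.
Proof.
move=> fp; rewrite /interior /=; apply: (@filter_forall _ _ (fun i q => f i q <= 0)) => i.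
have neg_nbhs : nbhs (f i p) [set y : R | y < 0]
  by apply: open_nbhs_nbhs; split; [exact: open_lt|exact: fp].
have near_p : \forall q \near p, f i q < 0 := f_cont i p _ neg_nbhs.
by apply: filterS near_p => q /ltW.
Qed.

Lemma convex_set_sublevel :
  convex_set ([set q | forall i, f i q <= 0] : set (convex_lmodType E)).
Proof.
move=> p q t; rewrite !inE /= => fp fq i.
apply: (le_trans (f_convex i p q _ _ _)) => //.
have t0 : 0 <= t%:num by [].
have t1 : t%:num <= 1 by [].
move: (fp i) (fq i) => fpi fqi; nra.
Qed.

(** A Slater point suffices: by convexity, the segment from any point of the set to [p0] satisfies
    all inequalities strictly past its first endpoint, so every point is a limit of interior
    points. *)
Lemma region_sublevel p0 :
  (forall i, f i p0 < 0) -> region [set q | forall i, f i q <= 0].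
Proof.
move=> fp0; split; first by exists p0 => i; exact/ltW.
apply/seteqP; split.
  have clS : closed [set q | forall i, f i q <= 0].
    rewrite [X in closed X](_ : _ = \bigcap_i (f i @^-1` [set y | y <= 0])).
      apply: closed_bigI => i _; apply: preimage_closed => [p _|]; first exact: f_cont.
      exact: closed_le.
    by apply/seteqP; split=> [p fp i _|p fp i]; [exact: fp|exact: fp].
  move/closure_id: clS => {2}->.
  by apply: closure_subset; apply: interior_subset.
move=> p fp U Up.
have ray_U := nbhs_ray p (p0 - p) U Up.
near (0 : R)^'+ => t.
have t0 : 0 < t by [].
have t1 : t < 1 by near: t; exact: nbhs_right_lt.
exists (p + t *: (p0 - p)); split; last by near: t.
have -> : p + t *: (p0 - p) = t *: p0 + (1 - t) *: p.
  by rewrite scalerBr scalerBl scale1r addrCA.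
apply: strict_sublevel_interior => i.
apply: le_lt_trans (f_convex i _ _ _ (ltW t0) (ltW t1)) _.
move: (fp i) (fp0 i) => /= *; nra.
Unshelve. all: by end_near. Qed.

End convex_sublevel.

(** * The planar regions and their inclusions *)

Section parabola_regions.
Context {R : realType} {V : finType} {le tight : rel V}.
Variables (x a b h : V -> R) (M : R).
Hypothesis x_in : forall w, a w < x w < b w.
Hypothesis nested : forall v w, le v w -> v != w -> a w < a v /\ b v < b w.
Hypothesis separated :
  forall v w, ~~ le v w -> ~~ le w v -> b v < a w \/ b w < a v.
Hypothesis gap : forall u w, ~~ le u w -> x u + 1 <= a w \/ b w + 1 <= x u.
Hypothesis h_in : forall w, 0 < h w < 1.
Hypothesis h_lt : forall v w, le v w -> v != w -> h v < h w.
Hypothesis M_ge : forall w, x w ^+ 2 + 1 <= M.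
Hypothesis tight_le :
  forall u v w, le u v -> le v w -> tight u w -> tight u v.

(* The region of [w] is the box [a w, b w] x ]-oo, M + h w] cut by the parabola
   Y = X^2 lowered by [h w] and by its tangents at the markers [x u]; these are
   not lowered when [tight u w], so that the region then has (x u, x u ^ 2) on
   its boundary. *)
Let slack w (i : option (option (option (option V)))) (p : 'rV[R]_2) : R :=
  let X := p 0 0 in let Y := p 0 1 in
  match i with
  | None => a w - X
  | Some None => X - b w
  | Some (Some None) => Y - (M + h w)
  | Some (Some (Some None)) => X ^+ 2 - h w - Y
  | Some (Some (Some (Some u))) =>
      2 * x u * X - x u ^+ 2 - (if tight u w then 0 else h w) - Y
  end.

Definition parabola_region w : set 'rV[R]_2 :=
  [set p | forall i, slack w i p <= 0].

Let point (X Y : R) : 'rV[R]_2 := \row_j (if j == 0 then X else Y).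

Let point0 X Y : point X Y 0 0 = X. Proof. by rewrite mxE. Qed.
Let point1 X Y : point X Y 0 1 = Y. Proof. by rewrite mxE. Qed.

Let slack_cont w i : continuous (slack w i).
Proof.
have X_cont : continuous (fun p : 'rV[R]_2 => p 0 0) by exact: coord_continuous.
have Y_cont : continuous (fun p : 'rV[R]_2 => p 0 1) by exact: coord_continuous.
have contB (f g : 'rV[R]_2 -> R) : continuous f -> continuous g ->
    continuous (fun p => f p - g p).
  by move=> cf cg p; apply: continuousB; [exact: cf|exact: cg].
have contM (f g : 'rV[R]_2 -> R) : continuous f -> continuous g ->
    continuous (fun p => f p * g p).
  by move=> cf cg p; apply: continuousM; [exact: cf|exact: cg].
have cst c : continuous (fun _ : 'rV[R]_2 => c : R) by exact: cst_continuous.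
case: i => [[[[u|]|]|]|].
- by do 3![apply: (contB) => //]; exact: contM.
- by do 2![apply: (contB) => //]; exact: contM.
- exact: contB.
- exact: contB.
- exact: contB.
Qed.

Let slack_convex w i p q t : 0 <= t -> t <= 1 ->
  slack w i (t *: p + (1 - t) *: q) <= t * slack w i p + (1 - t) * slack w i q.
Proof.
move=> t0 t1; case: i => [[[[u|]|]|]|] /=; rewrite !mxE; try lra.
have : 0 <= t * (1 - t) * (p 0 0 - q 0 0) ^+ 2.
  by rewrite mulr_ge0 ?sqr_ge0// mulr_ge0// subr_ge0.
lra.
Qed.

(** Since [M] exceeds every [x w ^+ 2], this point lies above the parabola, hence above all its
    tangents, and still below the cap [M + h w]. It is the Slater point of the region. *)
Let peak w i : slack w i (point (x w) M) < 0.
Proof.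
have := x_in w; have := h_in w; have := M_ge w => M_w h_w x_w.
case: i => [[[[u|]|]|]|] /=; rewrite ?point0 ?point1; try lra.
have : 0 <= (x u - x w) ^+ 2 by exact: sqr_ge0.
by case: (tight u w); lra.
Qed.

Lemma parabola_region_region w : region (parabola_region w).
Proof. exact: region_sublevel (slack_cont w) (slack_convex w) _ (peak w). Qed.

Lemma parabola_region_convex w :
  convex_set (parabola_region w : set (convex_lmodType 'rV[R]_2)).
Proof. exact: convex_set_sublevel (slack_convex w). Qed.

Let parabola_region_box w p : parabola_region w p -> a w <= p 0 0 <= b w.
Proof.
by move=> wp; have /= := wp None; have /= := wp (Some None); lra.
Qed.

Lemma parabola_region_disjoint v w : ~~ le v w -> ~~ le w v ->
  parabola_region v `&` parabola_region w = set0.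
Proof.
move=> vw wv; apply/seteqP; split=> // p [/parabola_region_box + /parabola_region_box].
by case: (separated v w vw wv) => /= *; lra.
Qed.

(** The peak of [w] is interior to its region, but its abscissa [x w] falls outside the interval of
    [v]. Having the interior on the left serves properness for both TPP and NTPP. *)
Lemma parabola_region_not_subset v w : le v w -> ~~ le w v ->
  ~ interior (parabola_region w) `<=` parabola_region v.
Proof.
move=> vw wv /(_ (point (x w) M)) sub.
have /parabola_region_box : parabola_region v (point (x w) M).
  apply: sub; apply: (strict_sublevel_interior (slack w) (slack_cont w)).
  exact: peak.
by rewrite point0; case: (gap w v wv) => *; lra.
Qed.

(* Away from [x u] the tangent there lies at least 1 below the parabola, hence
   below every lowered parabola. *)
Let tangent_gap u v p : ~~ le u v -> parabola_region v p ->
  2 * x u * p 0 0 - x u ^+ 2 < p 0 1.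
Proof.
move=> uv vp; have /andP[av bv] := parabola_region_box v p vp.
have /= := vp (Some (Some (Some None))); have /andP[_ h1] := h_in v.
have : 1 <= (p 0 0 - x u) ^+ 2 by case: (gap u v uv) => *; nra.
lra.
Qed.

Lemma parabola_region_subset v w : le v w -> v != w ->
  parabola_region v `<=` parabola_region w.
Proof.
move=> vw neq p vp; have box := parabola_region_box v p vp.
have [aa bb] := nested v w vw neq; have hh := h_lt v w vw neq.
case=> [[[[u|]|]|]|] /=.
- case: (boolP (le u v)) => uv; last first.
    have := tangent_gap u v p uv vp; have := h_in w.
    by case: (tight u w); lra.
  (* The region of [v] has its own tangent at [x u]. It is unlowered whenever that of [w] is, by
     [tight_le]; otherwise it is lowered by at most [h v < h w]. *)
  have /= := vp (Some (Some (Some (Some u)))).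
  case: (boolP (tight u w)) => [uw|_].
    by rewrite (tight_le u v w).
  by have := h_in w; case: (tight u v); lra.
- by have /= := vp (Some (Some (Some None))); lra.
- by have /= := vp (Some (Some None)); lra.
- lra.
- lra.
Qed.

(** Every inequality of [w] becomes strict on the region of [v]. In particular, tangents at markers
    below [v] are lowered by [h w], so they stay under the parabola lowered by only [h v]. *)
Lemma parabola_region_subset_interior v w : le v w -> v != w ->
  (forall u, le u v -> ~~ tight u w) ->
  parabola_region v `<=` interior (parabola_region w).
Proof.
move=> vw neq loose p vp; have box := parabola_region_box v p vp.
have [aa bb] := nested v w vw neq; have hh := h_lt v w vw neq.
apply: (strict_sublevel_interior (slack w) (slack_cont w)).
case=> [[[[u|]|]|]|] /=.
- case: (boolP (le u v)) => uv; last first.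
    have := tangent_gap u v p uv vp; have := h_in w.
    by case: (tight u w); lra.
  rewrite (negbTE (loose u uv)).
  have : 0 <= (p 0 0 - x u) ^+ 2 by exact: sqr_ge0.
  by have /= := vp (Some (Some (Some None))); lra.
- by have /= := vp (Some (Some (Some None))); lra.
- by have /= := vp (Some (Some None)); lra.
- lra.
- lra.
Qed.

(** The contact point is on the unlowered parabola, above all tangents, so it belongs to the region
    of [v]; it also lies on the unlowered tangent bounding [w], so any step straight down leaves the
    region of [w]. *)
Lemma parabola_region_touch v w : tight v w ->
  ~ parabola_region v `<=` interior (parabola_region w).
Proof.
move=> vw /(_ (point (x v) (x v ^+ 2))) sub.
have : interior (parabola_region w) (point (x v) (x v ^+ 2)).
  apply: sub; have := x_in v; have := h_in v; have := M_ge v => Mv hv xv.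
  case=> [[[[u|]|]|]|] /=; rewrite ?point0 ?point1; try lra.
  have : 0 <= (x u - x v) ^+ 2 by exact: sqr_ge0.
  by case: (tight u v); lra.
rewrite /interior /= => w_nbhs.
have ray_w := nbhs_ray _ (point 0 (-1)) _ w_nbhs.
near (0 : R)^'+ => t.
have t0 : 0 < t by [].
have /(_ (Some (Some (Some (Some v))))) /= :
  parabola_region w (point (x v) (x v ^+ 2) + t *: point 0 (-1)) by near: t.
by rewrite vw !mxE /=; lra.
Unshelve. all: by end_near. Qed.

End parabola_regions.

(** * From an arbitrary solution to the planar one *)

Local Notation no_contact_relations := [set DC; TPP; TPPi; NTPP; NTPPi].

Lemma proper_interior {T : topologicalType} {A B : set T} :
  A `<` interior B -> A `<` B.
Proof.
move=> [AB BA]; split; first exact: subset_trans AB (@interior_subset _ B).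
by move=> BsubA; apply: BA; exact: subset_trans (@interior_subset _ B) BsubA.
Qed.

Lemma disjoint_or_proper {T : topologicalType} {A B : set T} {r : rcc8} :
  no_contact_relations r -> rcc8_rel r A B ->
  [\/ A `&` B = set0, A `<` B | B `<` A].
Proof.
case: r => /=; try by move=> [[[[|]|]|]|].
- by move=> _ ?; constructor 1.
- by move=> _ [? _]; constructor 2.
- by move=> _ [? _]; constructor 3.
- by move=> _ /proper_interior; constructor 2.
- by move=> _ /proper_interior; constructor 3.
Qed.

(** Serves to turn interval lengths into heights below 1 with the same order. *)
Lemma bounded_increasing {R : realFieldType} :
  exists f : R -> R, (forall y, 0 < y -> 0 < f y < 1) /\
    (forall y z, 0 < y -> y < z -> f y < f z).
Proof.
exists (fun y => 1 - (1 + y)^-1); split=> [y y0|y z y0 yz].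
  have : 0 < (1 + y)^-1 by rewrite invr_gt0; lra.
  have : (1 + y)^-1 < 1 by rewrite invf_lt1; lra.
  lra.
by rewrite ltrD2l ltrN2 ltf_pV2 ?posrE; lra.
Qed.

Lemma finite_upper_bound {R : realFieldType} {T : finType} (f : T -> R) :
  exists M, forall w, f w <= M.
Proof.
exists (\sum_w `|f w|) => w; rewrite (bigD1 w)//=.
by rewrite (le_trans (ler_norm _))// lerDl sumr_ge0.
Qed.

Theorem proposition8 (R : realType) (V : finType) (N : rcc8_network V) :
  atomic N ->
  network_over N [set DC; TPP; TPPi; NTPP; NTPPi] ->
  consistent R N ->
  exists S : V -> set 'rV[R]_2, convex_solution N S.
Proof.
move=> atomN overN [n [_ [S0 [regS0 solS0]]]].
pose le u v := `[< S0 u `<=` S0 v >].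
(* This also holds for [u = w] and for disjoint sets; in the latter case the unlowered tangent is
   harmless by [tangent_gap]. *)
pose tight u w := ~~ `[< S0 u `<` interior (S0 w) >].
have leP u v : reflect (S0 u `<=` S0 v) (le u v) by exact: asboolP.
have S0_neq0 u : S0 u !=set0 by have [] := regS0 u.
have S0_cases u v : u <> v ->
    [\/ S0 u `&` S0 v = set0, S0 u `<` S0 v | S0 v `<` S0 u].
  move=> /atomN[c [cN ends _]]; have [r cr rel_r] := solS0 c cN.
  have := disjoint_or_proper (overN c cN r cr) rel_r.
  case: ends => -[-> ->] // [disj|lt|lt];
    [by constructor 1; rewrite setIC|by constructor 3|by constructor 2].
have le_refl : reflexive le by move=> u; exact/leP.
have le_trans : transitive le.
  by move=> v u w /leP uv /leP vw; apply/leP; exact: subset_trans uv vw.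
(* Distinct variables have distinct sets: equality is not an allowed relation, and a nonempty set is
   not disjoint from itself. *)
have le_anti : antisymmetric le.
  move=> u v /andP[/leP uv /leP vu]; apply: contrapT => /S0_cases[disj|[]|[]] //.
  have [p up] := S0_neq0 u.
  by have : (S0 u `&` S0 v) p := conj up (uv p up); rewrite disj.
have le_laminar u v w : le u v -> le u w -> le v w || le w v.
  move=> /leP uv /leP uw; have [->|/eqP/S0_cases[disj|[vw _]|[wv _]]] := eqVneq v w.
  - by rewrite le_refl.
  - have [p up] := S0_neq0 u.
    by have : (S0 v `&` S0 w) p := conj (uv p up) (uw p up); rewrite disj.
  - by rewrite (introT (leP v w) vw).
  - by rewrite (introT (leP w v) wv) orbT.
have tight_le u v w : le u v -> le v w -> tight u w -> tight u v.
  move=> _ /leP vw; apply: contra => /asboolP[uv vu]; apply/asboolP.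
  have int_vw := interiorS vw.
  split; first exact: subset_trans uv int_vw.
  by move=> wu; apply: vu; exact: subset_trans int_vw wu.
have [x [a [b [x_in nested separated gap]]]] :=
  laminar_intervals (R := R) le_refl le_trans le_anti le_laminar.
have [f [f_in f_incr]] := bounded_increasing (R := R).
pose h w := f (b w - a w).
have h_in w : 0 < h w < 1 by apply: f_in; have := x_in w; lra.
have h_lt v w : le v w -> v != w -> h v < h w.
  move=> vw neq; have := nested v w vw neq; have := x_in v.
  by move=> *; apply: f_incr; lra.
have [M M_ge] := finite_upper_bound (fun w => x w ^+ 2 + 1).
pose S := @parabola_region R V tight x a b h M.
exists S; split; last by move=> v; exact: parabola_region_convex.
split=> [v|c cN].
  exact: parabola_region_region x_in h_in M_ge _.
(* The new regions realize the same base relation [r] as the given solution. *)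
have [r cr rel_r] := solS0 c cN; exists r => //.
move: (lhs c) (rhs c) rel_r (overN c cN r cr) => u v.
have proper_le w w' : S0 w `<` S0 w' -> [/\ le w w', ~~ le w' w & w != w'].
  move=> [ww' w'w]; split; [exact/leP|exact/leP|].
  by apply/eqP => eq_ww'; apply: w'w; rewrite eq_ww'.
have not_sub w w' : S0 w `<` S0 w' -> ~ interior (S w') `<=` S w.
  move=> /proper_le[ww' w'w _].
  exact: parabola_region_not_subset x_in gap h_in M_ge w w' ww' w'w.
have sol_TPP w w' : rcc8_rel TPP (S0 w) (S0 w') -> rcc8_rel TPP (S w) (S w').
  move=> [ww' touch]; have [le_ww' _ neq] := proper_le w w' ww'.
  split; first split.
  - exact: parabola_region_subset nested gap h_in h_lt tight_le w w' le_ww' neq.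
  - by move=> w'w; apply: (not_sub w w' ww'); exact: subset_trans (@interior_subset _ _) w'w.
  - move=> [sub _]; apply: parabola_region_touch sub => //.
    exact/asboolPn.
have sol_NTPP w w' : rcc8_rel NTPP (S0 w) (S0 w') -> rcc8_rel NTPP (S w) (S w').
  move=> int_ww'; have ww' := proper_interior int_ww'.
  have [le_ww' _ neq] := proper_le w w' ww'; split; last exact: not_sub.
  (* Whatever is contained in [S0 w] is also a nontangential part of [S0 w'], so no marker below [w]
     is tight in [w']. *)
  apply: (parabola_region_subset_interior (le := le)) => // u' /leP u'w.
  apply/negPn/asboolP; case: int_ww' => sub nsub.
  split; first exact: subset_trans u'w sub.
  by move=> /subset_trans/(_ u'w).
case: r {cr} => // rel_r; try by move=> [[[[|]|]|]|].
- move=> _; apply: (parabola_region_disjoint (le := le)) => //; apply/leP => sub.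
    have [p up] := S0_neq0 u.
    by have : (S0 u `&` S0 v) p := conj up (sub p up); rewrite rel_r.
  have [p vp] := S0_neq0 v.
  by have : (S0 u `&` S0 v) p := conj (sub p vp) vp; rewrite rel_r.
- by move=> _; exact: sol_TPP.
- by move=> _; exact: sol_TPP.
- by move=> _; exact: sol_NTPP.
- by move=> _; exact: sol_NTPP.
Qed.
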